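(* Let $\lambda>0$ and $\mu$ be real numbers, and let $K_4-e$ be the graph obtained from the complete graph $K_4$ by removing one edge. The multiset $\{0, \lambda,\lambda, \mu\}$ is Laplacian realizable for $K_4 - e$ if and only if $\mu > 2\lambda$ or $0 < \mu \leq \frac{1}{2}\lambda$.
   Context: For a finite simple graph $G$ on $n$ vertices, $\mathcal{S}_L(G)$ denotes the set of $n\times n$ real symmetric matrices $A=[a_{i,j}]$ such that $a_{i,j}<0$ if $\{i,j\}\in E(G)$, $a_{i,j}=0$ if $i\neq j$ and $\{i,j\}\notin E(G)$, and $a_{i,i}=-\sum_{k\neq i}a_{i,k}$ for all $i$. A multiset of $n$ real numbers is Laplacian realizable for $G$ if it is the spectrum (multiset of eigenvalues) of some $A\in\mathcal{S}_L(G)$. *)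

(* Defs.v *)
From mathcomp Require Import all_boot all_order all_algebra.
From mathcomp Require Import reals.

Set Implicit Arguments.
Unset Strict Implicit.
Unset Printing Implicit Defensive.

Import Order.TTheory GRing.Theory Num.Theory.
Local Open Scope ring_scope.

Record sgraph (n : nat) := SGraph {
  edge :> rel 'I_n;
  edge_sym : symmetric edge;
  edge_irrefl : irreflexive edge }.

Definition complete_rel (n : nat) : rel 'I_n := [rel x y | x != y].

Lemma complete_sym n : symmetric (@complete_rel n).
Proof. by move=> x y; rewrite /complete_rel /= eq_sym. Qed.

Lemma complete_irrefl n : irreflexive (@complete_rel n).
Proof. by move=> x; rewrite /complete_rel /= eqxx. Qed.

Definition complete_graph (n : nat) : sgraph n :=
  SGraph (@complete_sym n) (@complete_irrefl n).

Definition remove_edge_rel n (G : sgraph n) (u v : 'I_n) : rel 'I_n :=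
  [rel x y | G x y && ([set x; y] != [set u; v])].

Lemma remove_edge_sym n (G : sgraph n) u v : symmetric (remove_edge_rel G u v).
Proof. by move=> x y; rewrite /remove_edge_rel /= edge_sym setUC. Qed.

Lemma remove_edge_irrefl n (G : sgraph n) u v :
  irreflexive (remove_edge_rel G u v).
Proof. by move=> x; rewrite /remove_edge_rel /= edge_irrefl. Qed.

Definition remove_edge n (G : sgraph n) (u v : 'I_n) : sgraph n :=
  SGraph (@remove_edge_sym n G u v) (@remove_edge_irrefl n G u v).

Definition in_SL (R : realType) n (G : sgraph n) (A : 'M[R]_n) : Prop :=
  [/\ A^T = A,
      forall i j, G i j -> A i j < 0,
      forall i j, i != j -> ~~ G i j -> A i j = 0 &
      forall i, A i i = - \sum_(k | k != i) A i k].

(* A multiset is represented by any sequence listing it; the order is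
   irrelevant here because the product is commutative.  Eigenvalues are
   counted with multiplicity as roots of the characteristic polynomial, and
   the equation forces size s = n. *)
Definition is_spectrum (R : realType) n (A : 'M[R]_n) (s : seq R) : Prop :=
  char_poly A = \prod_(x <- s) ('X - x%:P).

Definition laplacian_realizable (R : realType) n (G : sgraph n) (s : seq R) :
    Prop :=
  exists A : 'M[R]_n, in_SL G A /\ is_spectrum A s.

(* Main.v *)
Require Import Defs.
From mathcomp Require Import all_boot all_order all_fingroup all_algebra.
From mathcomp Require Import reals ring lra.

Import Order.TTheory GRing.Theory Num.Theory.
Local Open Scope ring_scope.

(** Let [A] be a weighted Laplacian of [K_4 - e], call [- A i j] the conductance
    of the pair [ij], and put [lambda = 4 * l].
    Since [A] kills the all-ones vector, its spectrum is
    [{0, lambda, lambda, mu}] exactly when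
    [N = A - lambda * (I - J / 4)], with [J] the all-ones matrix, has the
    spectrum [{0, 0, 0, mu - lambda}].  Now [N] is again a Laplacian, with every
    conductance lowered by [l]; the missing edge [uv] thus gets conductance
    [- l].  A real symmetric matrix with at most one nonzero eigenvalue has rank
    at most one, and [N] has the entry [l] at [uv], so its diagonal entry at [u]
    is not 0.  Writing [y], [z] for the lowered conductances of the edges [ua], [ub]
    at [u], and [S = y + z - l] for the diagonal entry of [N] at [u], one gets
    [N = w w^T / S] with [w = (S, l, - y, - z)].  All conductances are functions
    of [S], [y], [z], and there remain one equation, the trace
      [S^2 + l^2 + y^2 + z^2 = (mu - 4 l) S],
    and five inequalities saying that the remaining conductances are positive.

    If [S > 0], the inequality for the edge [ab] says [y z < l S], so the left
    side of the trace equation exceeds [2 (S^2 + l^2) >= 4 l S], that is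
    [mu > 8 l = 2 lambda].  If [S < 0], put [T = - S]; then [y] and [z] lie in
    the interval from [- l] to [T], and [(y + l) (T - y) > 0], with its analogue
    for [z], bounds the left side by less than [4 l T], so [mu > 0]; while
    [T^2 + l^2 >= 2 l T] gives [mu <= 2 l = lambda / 2].  Conversely, in
    both ranges of [mu] suitable [S], [y], [z] come from a quadratic equation
    ([rank_one_exists]).

    Ranks and spectra are handled without a spectral theorem.  The coefficients
    of the characteristic polynomial are written out in the six conductances
    ([char_poly_lap4]), lowering them acts by an explicit translation
    ([lap4_shift]), and rank one follows from a sum-of-squares identity
    ([lap4_rank_one]). *)

(** * Relabelling the vertices *)

Lemma char_poly_conj_perm (R : comNzRingType) n (s : 'S_n) (A : 'M[R]_n) :
  char_poly (\matrix_(i, j) A (s i) (s j)) = char_poly A.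
Proof.
rewrite /char_poly.
have -> : char_poly_mx (\matrix_(i, j) A (s i) (s j)) =
          row_perm s (col_perm s (char_poly_mx A)).
  by apply/matrixP=> i j; rewrite !mxE (inj_eq perm_inj).
rewrite row_permE col_permE !det_mulmx !det_perm odd_permV mulrCA.
by rewrite -signr_addb addbb mulr1.
Qed.

Lemma laplacian_realizable_relabel (R : realType) n (G G' : sgraph n)
    (s : 'S_n) (l : seq R) :
  (forall i j, G' i j = G (s i) (s j)) ->
  laplacian_realizable G l -> laplacian_realizable G' l.
Proof.
move=> GG' [A [[Asym Aneg A0 Adiag] Aspec]].
exists (\matrix_(i, j) A (s i) (s j)); split; last first.
  by rewrite /is_spectrum char_poly_conj_perm.
split=> [|i j|i j nij|i].
- by rewrite -[in LHS]Asym; apply/matrixP=> i j; rewrite !mxE.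
- by rewrite GG' mxE; apply: Aneg.
- by rewrite GG' mxE; apply: A0; rewrite (inj_eq perm_inj).
- rewrite mxE Adiag (reindex_inj (@perm_inj _ s)).
  congr (- _); apply: eq_big => [k|k _]; first by rewrite (inj_eq perm_inj).
  by rewrite mxE.
Qed.

(** The symmetric group acts 2-transitively; this reduces an arbitrary missing
    edge to one fixed edge. *)
Lemma perm_two_points n (a b u v : 'I_n) :
  a != b -> u != v -> exists s : 'S_n, s a = u /\ s b = v.
Proof.
move=> ab uv; exists (tperm a u * tperm (tperm a u b) v)%g.
have ub : tperm a u b != u.
  by rewrite -[X in _ != X](tpermL a u) (inj_eq perm_inj) eq_sym.
by split; rewrite permM tpermL //; apply: tpermD; rewrite // eq_sym.
Qed.

Lemma remove_edge_complete_perm n (s : 'S_n) (a b i j : 'I_n) :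
  remove_edge (complete_graph n) a b i j =
  remove_edge (complete_graph n) (s a) (s b) (s i) (s j).
Proof.
have im (x y : 'I_n) : [set s x; s y] = s @: [set x; y].
  by rewrite imsetU !imset_set1.
rewrite /=; congr (_ && ~~ _); last first.
  by rewrite !im (inj_eq (imset_inj (@perm_inj _ s))).
change ((i != j) = (s i != s j)).
by rewrite (inj_eq perm_inj).
Qed.

(** * Laplacians of order four and their characteristic polynomials *)

(** The Laplacian of [K_4] with arbitrary conductances, possibly zero or
    negative.  A letter and its primed version belong to opposite edges:
    [x] = 01, [x'] = 23, [y] = 02, [y'] = 13, [z] = 03, [z'] = 12. *)
Definition lap4 {R : pzRingType} (x x' y y' z z' : R) : 'M[R]_4 :=
  \matrix_(i, j) nth 0 (nth [::]
    [:: [:: x + y + z; - x; - y; - z];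
        [:: - x; x + y' + z'; - z'; - y'];
        [:: - y; - z'; x' + y + z'; - x'];
        [:: - z; - y'; - x'; x' + y' + z]] i) j.

(** [lap_e1], [lap_e2], [lap_e3] are the elementary symmetric functions of the
    three eigenvalues of [lap4] other than the trivial eigenvalue 0.  By the
    matrix-tree theorem, [lap_e3] is four times the sum over spanning trees,
    and [lap_e2] sums over the two-edge forests, weighted by the product of the
    sizes of their components: 3 for adjacent edges, 4 for opposite ones. *)
Definition lap_e1 {R : pzRingType} (x x' y y' z z' : R) : R :=
  2 * (x + x' + y + y' + z + z').

Definition lap_e2 {R : pzRingType} (x x' y y' z z' : R) : R :=
  3 * ((x + x') * (y + y') + (x + x') * (z + z') + (y + y') * (z + z'))
  + 4 * (x * x' + y * y' + z * z').

Definition lap_e3 {R : pzRingType} (x x' y y' z z' : R) : R :=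
  4 * (x * x' * (y + y' + z + z') + y * y' * (x + x' + z + z')
       + z * z' * (x + x' + y + y')
       + x * y * z + x * y' * z' + x' * y * z' + x' * y' * z).

Lemma det3 (R : comNzRingType) (a : nat -> nat -> R) :
  \det (\matrix_(i < 3, j < 3) a i j) =
    a 0 0 * (a 1 1 * a 2 2 - a 1 2 * a 2 1)
  - a 0 1 * (a 1 0 * a 2 2 - a 1 2 * a 2 0)
  + a 0 2 * (a 1 0 * a 2 1 - a 1 1 * a 2 0).
Proof.
do 2! rewrite !(expand_det_row _ ord0) !(big_ord_recl, big_ord0) /cofactor.
rewrite !det_mx11 !mxE /=.
ring.
Qed.

Lemma det4 (R : comNzRingType) (a : nat -> nat -> R) :
  \det (\matrix_(i < 4, j < 4) a i j) =
    (a 0 0 * a 1 1 - a 0 1 * a 1 0) * (a 2 2 * a 3 3 - a 2 3 * a 3 2)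
  - (a 0 0 * a 1 2 - a 0 2 * a 1 0) * (a 2 1 * a 3 3 - a 2 3 * a 3 1)
  + (a 0 0 * a 1 3 - a 0 3 * a 1 0) * (a 2 1 * a 3 2 - a 2 2 * a 3 1)
  + (a 0 1 * a 1 2 - a 0 2 * a 1 1) * (a 2 0 * a 3 3 - a 2 3 * a 3 0)
  - (a 0 1 * a 1 3 - a 0 3 * a 1 1) * (a 2 0 * a 3 2 - a 2 2 * a 3 0)
  + (a 0 2 * a 1 3 - a 0 3 * a 1 2) * (a 2 0 * a 3 1 - a 2 1 * a 3 0).
Proof.
have minorE (j : 'I_4) : row' ord0 (col' j (\matrix_(i < 4, j < 4) a i j)) =
    \matrix_(i < 3, k < 3) a i.+1 (bump j k).
  by apply/matrixP=> i k; rewrite !mxE.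
rewrite (expand_det_row _ ord0) /cofactor.
under eq_bigr => j _ do
  rewrite minorE (det3 _ (fun i k => a i.+1 (bump j k))) mxE.
rewrite !(big_ord_recl, big_ord0) /=.
ring.
Qed.

Lemma char_poly_lap4 (R : comNzRingType) (x x' y y' z z' : R) :
  char_poly (lap4 x x' y y' z z') =
  'X * ('X^3 - (lap_e1 x x' y y' z z') *: 'X^2
        + (lap_e2 x x' y y' z z') *: 'X - (lap_e3 x x' y y' z z')%:P).
Proof.
pose a (i j : nat) : {poly R} :=
  'X *+ (i == j) - (lap4 x x' y y' z z' (inord i) (inord j))%:P.
have -> : char_poly (lap4 x x' y y' z z') = \det (\matrix_(i < 4, j < 4) a i j).
  by congr (\det _); apply/matrixP=> i j; rewrite !mxE /a !inord_val mxE.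
rewrite (det4 _ a) /a !mxE !inordK //= /lap_e1 /lap_e2 /lap_e3 -!mul_polyC.
ring.
Qed.

Lemma char_poly_lap4_coef (R : comNzRingType) (x x' y y' z z' l m : R) :
  char_poly (lap4 x x' y y' z z') = \prod_(a <- [:: 0; l; l; m]) ('X - a%:P)
  <-> [/\ lap_e1 x x' y y' z z' = 2 * l + m,
          lap_e2 x x' y y' z z' = l ^+ 2 + 2 * (l * m) &
          lap_e3 x x' y y' z z' = l ^+ 2 * m].
Proof.
rewrite char_poly_lap4 !big_cons big_nil.
have -> : ('X - 0%:P) * (('X - l%:P) * (('X - l%:P) * (('X - m%:P) * 1))) =
  'X * ('X^3 - (2 * l + m) *: 'X^2
     + (l ^+ 2 + 2 * (l * m)) *: 'X - (l ^+ 2 * m)%:P) :> {poly R}.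
  by rewrite -!mul_polyC; ring.
split=> [E|[-> -> ->] //].
have c k := congr1 (fun p : {poly R} => p`_k.+1) E.
have simp := (coefXM, coefB, coefD, coefZ, coefXn, coefX, coefC,
  oppr0, mulr0, mulr1, subr0, addr0, add0r, sub0r).
split; [apply: oppr_inj; have := c 2%N | have := c 1%N
          | apply: oppr_inj; have := c 0%N]; by rewrite !simp /= ?simp.
Qed.

(** * Reduction to rank one *)

(** Lowering all conductances by [l] subtracts [4 * l] from each of the three
    nontrivial eigenvalues, because it subtracts [4 * l * (I - J / 4)] from the
    matrix.  Here it turns the eigenvalues [4 * l], [4 * l], [m] into
    [0], [0], [m - 4 * l]. *)
Lemma lap4_shift (R : realFieldType) (x x' y y' z z' l m : R)
    (e := fun f : R -> R -> R -> R -> R -> R -> R =>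
            f (x - l) (x' - l) (y - l) (y' - l) (z - l) (z' - l)) :
  [/\ lap_e1 x x' y y' z z' = 2 * (4 * l) + m,
      lap_e2 x x' y y' z z' = (4 * l) ^+ 2 + 2 * (4 * l * m) &
      lap_e3 x x' y y' z z' = (4 * l) ^+ 2 * m] <->
  [/\ e lap_e1 = m - 4 * l, e lap_e2 = 0 & e lap_e3 = 0].
Proof.
have s1 : e lap_e1 = lap_e1 x x' y y' z z' - 3 * (4 * l).
  by rewrite /e /lap_e1; ring.
have s2 : e lap_e2 = lap_e2 x x' y y' z z'
    - 2 * (4 * l) * lap_e1 x x' y y' z z' + 3 * (4 * l) ^+ 2.
  by rewrite /e /lap_e1 /lap_e2; ring.
have s3 : e lap_e3 = lap_e3 x x' y y' z z' - 4 * l * lap_e2 x x' y y' z z'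
    + (4 * l) ^+ 2 * lap_e1 x x' y y' z z' - (4 * l) ^+ 3.
  by rewrite /e /lap_e1 /lap_e2 /lap_e3; ring.
rewrite s1 s2 s3; split=> [[-> -> ->]|[E1 E2 E3]]; first by split; ring.
have {}E1 : lap_e1 x x' y y' z z' = 2 * (4 * l) + m by lra.
rewrite E1 in E2 E3 *.
have {}E2 : lap_e2 x x' y y' z z' = (4 * l) ^+ 2 + 2 * (4 * l * m) by lra.
by rewrite E2 in E3 *; split=> //; lra.
Qed.

(** Vanishing of [lap_e2] and [lap_e3] leaves at most one nonzero eigenvalue, so
    [N := lap4 x x' y y' z z'] has rank at most one; the conclusions are the
    three minors [N 0 0 * N j k = N 0 j * N 0 k] with [0, j, k] distinct.
    With at most one nonzero eigenvalue, the symmetric matrix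
    [N ^ 2 - (\tr N) N] is zero.  This is read off from the trace of its square,
    a sum of squares of real numbers: with [e_i] for [lap_ei], that trace is
    [2 (e_2 ^ 2 - e_1 e_3)] for every [N] of this form.  The minors are linear
    combinations of its entries. *)
Lemma lap4_rank_one (R : realFieldType) (x x' y y' z z' : R) :
  lap_e2 x x' y y' z z' = 0 -> lap_e3 x x' y y' z z' = 0 ->
  [/\ (x + y + z) * x' = - (y * z), (x + y + z) * y' = - (x * z) &
      (x + y + z) * z' = - (x * y)].
Proof.
move=> e2 e3.
(* The off-diagonal entries of N ^ 2 - (\tr N) N; its rows sum to zero, so the
   diagonal entries are the opposites of the sums below. *)
pose kx := x * (2 * x' + y + y' + z + z') + y * z' + y' * z.
pose kx' := x' * (2 * x + y + y' + z + z') + y * z + y' * z'.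
pose ky := y * (2 * y' + x + x' + z + z') + x * z' + x' * z.
pose ky' := y' * (2 * y + x + x' + z + z') + x * z + x' * z'.
pose kz := z * (2 * z' + x + x' + y + y') + x * y' + x' * y.
pose kz' := z' * (2 * z + x + x' + y + y') + x * y + x' * y'.
have sos : (kx + ky + kz) ^+ 2 + (kx + ky' + kz') ^+ 2 + (kx' + ky + kz') ^+ 2
    + (kx' + ky' + kz) ^+ 2
    + 2 * (kx ^+ 2 + kx' ^+ 2 + ky ^+ 2 + ky' ^+ 2 + kz ^+ 2 + kz' ^+ 2) = 0.
  transitivity (2 * (lap_e2 x x' y y' z z' ^+ 2
      - lap_e1 x x' y y' z z' * lap_e3 x x' y y' z z')).
    by rewrite /lap_e1 /lap_e2 /lap_e3 /kx /kx' /ky /ky' /kz /kz'; ring.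
  by rewrite e2 e3; ring.
have zero (t : R) : t ^+ 2 <= 0 -> t = 0.
  move=> t2; apply/eqP; rewrite -sqrf_eq0; apply/eqP/le_anti/andP.
  by split=> //; apply: sqr_ge0.
have [[KX KX'] [KY KY'] [KZ KZ']] :
    [/\ kx = 0 /\ kx' = 0, ky = 0 /\ ky' = 0 & kz = 0 /\ kz' = 0].
  clearbody kx kx' ky ky' kz kz'.
  have := sqr_ge0 (kx + ky + kz); have := sqr_ge0 (kx + ky' + kz').
  have := sqr_ge0 (kx' + ky + kz'); have := sqr_ge0 (kx' + ky' + kz).
  have := sqr_ge0 kx; have := sqr_ge0 kx'; have := sqr_ge0 ky.
  have := sqr_ge0 ky'; have := sqr_ge0 kz; have := sqr_ge0 kz'.
  by move=> *; split; split; apply: zero; lra.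
move: KX KX' KY KY' KZ KZ'; rewrite /kx /kx' /ky /ky' /kz /kz' => *; split; lra.
Qed.

(** * The rank-one system *)

(** The last three inequalities are the positivity of the conductances
    [l * (1 + y / S)], [l * (1 + z / S)] and [l - y * z / S] of the edges that
    avoid the vertex [u]. *)
Lemma rank_one_bounds (R : realFieldType) (l m S y z : R) :
  0 < l -> S != 0 -> y + z = S + l ->
  S ^+ 2 + l ^+ 2 + y ^+ 2 + z ^+ 2 = (m - 4 * l) * S ->
  - l < y -> - l < z -> -1 < y / S -> -1 < z / S -> - l < - (y * z) / S ->
  8 * l < m \/ 0 < m <= 2 * l.
Proof.
move=> l0 S0 yz tr ly lz yS zS yzS.
case: (ltrP 0 S) => [Sp|]; last first.
  rewrite le_eqVlt (negbTE S0) /= => Sn; right.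
  have yltT : y < - S by move: yS; rewrite ltr_ndivlMr // mulN1r.
  have zltT : z < - S by move: zS; rewrite ltr_ndivlMr // mulN1r.
  have y2 : 0 < (y + l) * (- S - y) by rewrite mulr_gt0 //; lra.
  have z2 : 0 < (z + l) * (- S - z) by rewrite mulr_gt0 //; lra.
  have zE : z = S + l - y by lra.
  subst z; apply/andP; split.
    have mS : m * S < 0 by lra.
    by rewrite -(nmulr_llt0 m Sn).
  rewrite -(ler_nM2r Sn); have := sqr_ge0 (S + l).
  by have := sqr_ge0 (S + l - y); have := sqr_ge0 y; lra.
left.
have yzlt : y * z < l * S by move: yzS; rewrite ltr_pdivlMr // mulNr ltrN2.
have zE : z = S + l - y by lra.
subst z; rewrite -(ltr_pM2r Sp); have := sqr_ge0 (S - l); lra.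
Qed.

(** In each range of [m], one further relation between [y], [z] and [S] leaves
    a quadratic equation for [S] alone. *)
Lemma rank_one_exists (R : rcfType) (l m : R) :
  0 < l -> 8 * l < m \/ 0 < m <= 2 * l ->
  exists S y z : R, [/\ S != 0, y + z = S + l,
   S ^+ 2 + l ^+ 2 + y ^+ 2 + z ^+ 2 = (m - 4 * l) * S,
   - l < y /\ - l < z & [/\ -1 < y / S, -1 < z / S & - l < - (y * z) / S]].
Proof.
move=> l0 [lm|/andP[m0 ml]].
- (* With y = l the trace equation is solvable for every m >= 8 * l, but then
     y * z = l * S.  Lowering y slightly makes y * z < l * S, and this choice
     of d keeps the discriminant D nonnegative. *)
  set d := Num.min l (m / 2 - 4 * l).
  have d0 : 0 < d by rewrite /d lt_min l0 /=; lra.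
  have dl : d <= l by rewrite /d ge_min lexx.
  have dm : d <= m / 2 - 4 * l by rewrite /d ge_min lexx orbT.
  set b := m / 2 - 2 * l - d.
  set D := b ^+ 2 - 4 * (l ^+ 2 - d * l + d ^+ 2).
  have D0 : 0 <= D by rewrite /D /b; nra.
  set r := Num.sqrt D.
  have r0 : 0 <= r := sqrtr_ge0 D.
  have r2 : r ^+ 2 = D := sqr_sqrtr D0.
  set S := (b + r) / 2.
  have bl : 2 * l <= b by rewrite /b; lra.
  have Sl : l <= S by rewrite /S; lra.
  have S0 : 0 < S by lra.
  exists S, (l - d), (S + d); split; [by lra|by ring| |by split; lra|split].
  + have : S ^+ 2 = b * S - (l ^+ 2 - d * l + d ^+ 2).
      by rewrite /S; move: r2; rewrite /D => r2; field: r2.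
    by rewrite /b; nra.
  + by rewrite ltr_pdivlMr //; lra.
  + by rewrite ltr_pdivlMr //; lra.
  + by rewrite ltr_pdivlMr //; nra.
- (* The choice y = z = (l - T) / 2 turns the trace equation for S = - T into
     T ^ 2 - 2 * h * T + l ^ 2 = 0; the condition m <= 2 * l is h >= l, which
     makes it solvable, and 0 < m gives T < 3 * l, that is - l < y. *)
  set h := (5 * l - m) / 3.
  have hl : l <= h by rewrite /h; lra.
  have h5 : 3 * h < 5 * l by rewrite /h; lra.
  have D0 : 0 <= h ^+ 2 - l ^+ 2 by nra.
  set r := Num.sqrt (h ^+ 2 - l ^+ 2).
  have r0 : 0 <= r := sqrtr_ge0 _.
  have r2 : r ^+ 2 = h ^+ 2 - l ^+ 2 := sqr_sqrtr D0.
  have rl : r < 3 * l - h.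
    rewrite -(@ltr_pXn2r _ 2) ?nnegrE //; first by rewrite r2; nra.
    by lra.
  set T := h + r.
  have T0 : 0 < T by rewrite /T; lra.
  have T2 : T ^+ 2 = 2 * h * T - l ^+ 2 by rewrite /T; nra.
  exists (- T), ((l - T) / 2), ((l - T) / 2); split.
  + by rewrite oppr_eq0 gt_eqF.
  + by field.
  + by move: T2; rewrite /h; nra.
  + by rewrite /T; split; lra.
  + rewrite ltr_ndivlMr ?oppr_lt0 // ltr_ndivlMr ?oppr_lt0 //.
    by split; try (rewrite /T; lra); nra.
Qed.

(** * The graph obtained from K_4 by removing an edge *)

Lemma eq_set2 (T : finType) (a b c d : T) : a != b ->
  ([set a; b] == [set c; d]) = (a == c) && (b == d) || (a == d) && (b == c).
Proof.
move=> ab; apply/eqP/orP=> [E|[]/andP[/eqP-> /eqP->] //]; last by rewrite setUC.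
have := set21 a b; have := set22 a b; rewrite E !inE.
case/orP=> /eqP bE; case/orP=> /eqP aE; move: ab; rewrite aE bE ?eqxx //.
  by right.
by left.
Qed.

(** A pair of distinct indices other than {0, 1} is one whose sum exceeds 1. *)
Lemma K4_minus_e_edge (i j : nat) : (i < 4)%N -> (j < 4)%N ->
  remove_edge (complete_graph 4) (inord 0) (inord 1) (inord i) (inord j) =
  (i != j) && (1 < i + j)%N.
Proof.
move=> i4 j4.
transitivity ((inord i != inord j :> 'I_4)
   && ([set inord i; inord j] != [set inord 0; inord 1 : 'I_4])); first by [].
have [//|ij] := boolP (inord i == inord j :> 'I_4).
  by rewrite -val_eqE /= !inordK // => ->.
rewrite eq_set2 // -!val_eqE /= !inordK //.
move: ij; rewrite -val_eqE /= !inordK //.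
by case: i i4 => [|[|[|[|]]]] //; case: j j4 => [|[|[|[|]]]].
Qed.

Lemma lap4_in_SL (R : realType) (x x' y y' z z' : R) :
  in_SL (remove_edge (complete_graph 4) (inord 0) (inord 1))
        (lap4 x x' y y' z z') <->
  x = 0 /\ [/\ 0 < x', 0 < y, 0 < y', 0 < z & 0 < z'].
Proof.
have entry i j : (i < 4)%N -> (j < 4)%N ->
    lap4 x x' y y' z z' (inord i) (inord j) = nth 0 (nth [::]
    [:: [:: x + y + z; - x; - y; - z];
        [:: - x; x + y' + z'; - z'; - y'];
        [:: - y; - z'; x' + y + z'; - x'];
        [:: - z; - y'; - x'; x' + y' + z]] i) j.
  by move=> i4 j4; rewrite mxE !inordK.
split=> [[_ neg zero _]|[x0 [x'0 y0 y'0 z0 z'0]]].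
  have neg' i j : (i < 4)%N -> (j < 4)%N -> (i != j) && (1 < i + j)%N -> _ :=
    fun i4 j4 ij => neg (inord i) (inord j)
      (etrans (K4_minus_e_edge i j i4 j4) ij).
  split.
    have := zero (inord 0) (inord 1); rewrite entry // K4_minus_e_edge //=.
    rewrite -val_eqE /= !inordK // => /(_ isT isT)/eqP.
    by rewrite oppr_eq0 => /eqP.
  have := neg' 2 3 isT isT isT; have := neg' 0 2 isT isT isT.
  have := neg' 0 3 isT isT isT; have := neg' 1 2 isT isT isT.
  have := neg' 1 3 isT isT isT; rewrite !entry //= !oppr_lt0.
  by split.
split.
- apply/matrixP=> i j; rewrite !mxE.
  by case: i => [[|[|[|[|]]]] //= _]; case: j => [[|[|[|[|]]]] //= _].
- move=> i j; rewrite -(inord_val i) -(inord_val j) K4_minus_e_edge // entry //.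
  move: (val i) (val j) (ltn_ord i) (ltn_ord j) => {}i {}j /=.
  by case: i => [|[|[|[|]]]] //=; case: j => [|[|[|[|]]]] //= _ _ _;
    rewrite oppr_lt0.
- move=> i j; rewrite -(inord_val i) -(inord_val j) K4_minus_e_edge // entry //.
  rewrite -val_eqE /= !inordK //.
  move: (val i) (val j) (ltn_ord i) (ltn_ord j) => {}i {}j /=.
  by case: i => [|[|[|[|]]]] //=; case: j => [|[|[|[|]]]] //= _ _ _ _;
    rewrite x0 oppr0.
- move=> i; rewrite big_mkcond !(big_ord_recl, big_ord0) !mxE -!val_eqE /=.
  case: i => [[|[|[|[|]]]] //= _]; ring.
Qed.

Lemma in_SL_lap4 (R : realType) (G : sgraph 4) (A : 'M[R]_4)
    (w := fun i j : nat => - A (inord i) (inord j)) :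
  in_SL G A -> A = lap4 (w 0 1) (w 2 3) (w 0 2) (w 1 3) (w 0 3) (w 1 2).
Proof.
case=> sym _ _ diag.
have wC i j : w i j = w j i by rewrite /w -{1}sym mxE.
have off i j : A (inord i) (inord j) = - w i j by rewrite opprK.
have dg i : (i < 4)%N -> A (inord i) (inord i) =
    \sum_(k < 4) if k == i :> nat then 0 else w i k.
  move=> i4; rewrite diag -sumrN big_mkcond; apply: eq_bigr => k _.
  by rewrite -val_eqE /= inordK // /w inord_val; case: eqP.
apply/matrixP=> i j; rewrite mxE -{1}(inord_val i) -{1}(inord_val j).
move: (val i) (val j) (ltn_ord i) (ltn_ord j) => {}i {}j i4 j4.
have [<-|ij] := eqVneq i j.
  rewrite dg // !(big_ord_recl, big_ord0) /= /bump /=.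
  by case: i i4 => [|[|[|[|]]]] //= _; rewrite ?(wC 1 0) ?(wC 2 0) ?(wC 3 0)
    ?(wC 2 1) ?(wC 3 1) ?(wC 3 2); ring.
rewrite off; case: i j i4 j4 ij => [|[|[|[|]]]] //= [|[|[|[|]]]] //= _ _ _;
  by rewrite wC.
Qed.

Theorem theorem3p15 (R : realType) (lambda mu : R) (hlambda : 0 < lambda)
    (u v : 'I_4) (huv : edge (complete_graph 4) u v) :
  laplacian_realizable (remove_edge (complete_graph 4) u v)
    [:: 0; lambda; lambda; mu]
  <-> (2 * lambda < mu \/ (0 < mu /\ mu <= 2^-1 * lambda)).
Proof.
pose l := lambda / 4; have lE : lambda = 4 * l by rewrite /l; field.
have l0 : 0 < l by rewrite lE in hlambda; lra.
have ab : inord 0 != inord 1 :> 'I_4 by rewrite -val_eqE /= !inordK.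
have [s [su sv]] := perm_two_points _ (inord 0) (inord 1) u v ab huv.
have relabel i j := remove_edge_complete_perm _ s (inord 0) (inord 1) i j.
rewrite su sv in relabel.
have -> : laplacian_realizable (remove_edge (complete_graph 4) u v)
    [:: 0; lambda; lambda; mu] <->
  laplacian_realizable (remove_edge (complete_graph 4) (inord 0) (inord 1))
    [:: 0; lambda; lambda; mu].
  split; first exact: laplacian_realizable_relabel relabel.
  apply: (laplacian_realizable_relabel _ _ _ _ (s^-1)%g) => i j.
  by rewrite relabel !permKV.
have -> : (2 * lambda < mu \/ 0 < mu /\ mu <= 2^-1 * lambda) <->
    (8 * l < mu \/ 0 < mu <= 2 * l).
  have -> : 2 * lambda = 8 * l by rewrite lE; ring.
  have -> : 2^-1 * lambda = 2 * l by rewrite lE; field.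
  by split=> [[?|/andP ?]|[?|/andP ?]]; [left|right|left|right].
clearbody l; rewrite {}lE {hlambda}; split.
  case=> A [ASL]; rewrite /is_spectrum; move: (ASL).
  rewrite (in_SL_lap4 _ _ _ ASL).
  set x := - A _ _; set x' := - A _ _; set y := - A _ _.
  set y' := - A _ _; set z := - A _ _; set z' := - A _ _.
  clearbody x x' y y' z z' => /lap4_in_SL[x0 [x'0 y0 y'0 z0 z'0]].
  move=> /char_poly_lap4_coef/lap4_shift[E1 E2 E3].
  have [] := lap4_rank_one _ _ _ _ _ _ _ E2 E3.
  move: E1; rewrite /lap_e1 x0 sub0r.
  set S := - l + (y - l) + (z - l) => E1 X' Y' Z'.
  (* If S = 0 the minors give l * (y - l) = l * (z - l) = 0, so S = - l. *)
  have S0 : S != 0.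
    apply/eqP => S0; move: Y' Z'; rewrite S0 !mul0r => Y' Z'.
    have zl : z = l by nra.
    have yl : y = l by nra.
    by move: S0; rewrite /S zl yl; lra.
  have YS : y' = l * (1 + (z - l) / S).
    have : y' - l = l * (z - l) / S 
      by rewrite -[LHS](mulfK S0); congr (_ / _); lra.
    by move=> H; rewrite mulrDr mulr1 mulrA -H; ring.
  have ZS : z' = l * (1 + (y - l) / S).
    have : z' - l = l * (y - l) / S 
      by rewrite -[LHS](mulfK S0); congr (_ / _); lra.
    by move=> H; rewrite mulrDr mulr1 mulrA -H; ring.
  have XS : x' = l + - ((y - l) * (z - l)) / S.
    by rewrite -X' [S * _]mulrC mulfK //; ring.
  apply: (rank_one_bounds _ _ _ S (y - l) (z - l)) => //.
  - by rewrite /S; ring.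
  - have zE : z = S + 3 * l - y by rewrite /S; ring.
    clearbody S; rewrite -E1; rewrite zE in X' Y' Z' *; lra.
  - lra.
  - lra.
  - by move: z'0; rewrite ZS pmulr_rgt0 //; lra.
  - by move: y'0; rewrite YS pmulr_rgt0 //; lra.
  - by move: x'0; rewrite XS; lra.
move=> /(rank_one_exists _ _ _ l0)[S [y [z [S0 yz tr [ly lz] [yS zS yzS]]]]].
exists (lap4 0 (l - y * z / S)
               (l + y) (l * (1 + z / S)) (l + z) (l * (1 + y / S))).
split.
  apply/lap4_in_SL; split=> //; split; try lra.
  - by rewrite pmulr_rgt0 //; lra.
  - by rewrite pmulr_rgt0 //; lra.
apply/char_poly_lap4_coef/lap4_shift.
have zE : z = S + l - y by lra.
split.
- by apply: (mulIf S0); rewrite -tr /lap_e1 zE; field.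
- by rewrite /lap_e2 zE; field.
- by rewrite /lap_e3 zE; field.
Qed.
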